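(* Let $S$ be a finite set with $|S| = n$, and let $\mathcal{P}(S)$ be its power set lattice. Then there exists an algebraic representation $\mathbf{A} = (A, F)$ of $\mathcal{P}(S)$ such that $A$ has $2^n$ elements and $F$ consists of $2^n - n + \sum_{i=2}^{n} i\binom{n}{i}$ functions.
   Context: An algebraic structure is a pair $\mathbf{A} = (A, F)$ where $A$ is a set and $F$ is a set of functions (operations), each of the form $f : A^m \to A$ for some $m \in \mathbb{N} \cup \{0\}$ (the arity $m$ may depend on $f$; a nullary operation, $m=0$, is a distinguished constant in $A$). A subalgebra of $\mathbf{A}$ is a subset $B \subseteq A$ closed under every operation in $F$ (in particular containing every nullary constant), with the restricted operations. The subalgebras of $\mathbf{A}$, ordered by set inclusion, form a lattice $\mathbf{Sub}(\mathbf{A})$. An algebraic representation of a lattice $L$ is an algebraic structure $\mathbf{A}$ such that $\mathbf{Sub}(\mathbf{A})$ is isomorphic to $L$ as a lattice. The power set lattice $\mathcal{P}(S)$ is the set of all subsets of $S$ ordered by set inclusion. An empty sum is $0$. *)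

(* Defs.v *)
(* MathComp, with classical sets and cardinals from mathcomp-classical. *)
From HB Require Import structures.
From mathcomp Require Import all_boot all_order.
From mathcomp Require Import boolp classical_sets functions cardinality.

Set Implicit Arguments.
Unset Strict Implicit.
Unset Printing Implicit Defensive.

Import Order.TTheory.

Local Open Scope classical_set_scope.

(* Operations of different arities are different, and operations of the same
   arity are equal iff they are extensionally equal (functional
   extensionality), so cardinals of sets of operations are the usual ones. *)
Record operation (A : Type) := Operation {
  arity : nat;
  apply_op :> arity.-tuple A -> A
}.

Record algebra := Algebra {
  carrier :> Type;
  ops : set (operation carrier)
}.

Arguments ops : clear implicits.

(* For arity 0 the condition says that the constant belongs to B; when there
   is no constant, the empty set is closed. *)
Definition closed_under_ops (A : algebra) (B : set A) : Prop :=
  forall f, ops A f -> forall x : (arity f).-tuple A,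
    (forall i, B (tnth x i)) -> B (f x).

Record subalgebra (A : algebra) := Subalgebra {
  subalg_set :> set A;
  subalgP : closed_under_ops subalg_set
}.

HB.instance Definition _ (A : algebra) := gen_eqMixin (subalgebra A).
HB.instance Definition _ (A : algebra) := gen_choiceMixin (subalgebra A).

Fact subalgebra_display : Order.disp_t. Proof. exact: Order.Disp tt tt. Qed.

Section SubLattice.
Variable A : algebra.
Implicit Types B C D : subalgebra A.

Lemma subalgebra_inj B C : B = C :> set A -> B = C.
Proof.
case: B C => [B clB] [C clC] /= eBC; case: C / eBC clC => clC.
by congr Subalgebra; apply: Prop_irrelevance.
Qed.

Definition subalg_le B C : bool := `[< B `<=` C >].

Fact subalg_le_refl : reflexive subalg_le.
Proof. by move=> B; apply/asboolP. Qed.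

Fact subalg_le_anti : antisymmetric subalg_le.
Proof.
move=> B C /andP[/asboolP BC /asboolP CB].
by apply: subalgebra_inj; apply/seteqP.
Qed.

Fact subalg_le_trans : transitive subalg_le.
Proof.
move=> C B D /asboolP BC /asboolP CD.
by apply/asboolP; apply: subset_trans BC CD.
Qed.

HB.instance Definition _ := Order.Le_isPOrder.Build subalgebra_display
  (subalgebra A) subalg_le_refl subalg_le_anti subalg_le_trans.

Fact subalg_meet_closed B C : closed_under_ops (B `&` C).
Proof.
by move=> f Ff x BCx; split; apply: (subalgP Ff) => i; have [] := BCx i.
Qed.

Definition subalg_meet B C := Subalgebra (@subalg_meet_closed B C).

Fact generated_closed (X : set A) :
  closed_under_ops (smallest (@closed_under_ops A) X).
Proof.
move=> f Ff x Xx D [clD XD]; apply: (clD f Ff) => i; exact: (Xx i).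
Qed.

Definition generated_subalgebra (X : set A) := Subalgebra (@generated_closed X).

Definition subalg_join B C := generated_subalgebra (B `|` C).

Fact subalg_meetP B C D :
  (B <= subalg_meet C D)%O = (B <= C)%O && (B <= D)%O.
Proof.
apply/asboolP/andP => [BCD|[/asboolP BC /asboolP BD]].
  by split; apply/asboolP => x /BCD[].
by move=> x Bx; split; [apply: BC|apply: BD].
Qed.

Fact subalg_joinP B C D :
  (subalg_join B C <= D)%O = (B <= D)%O && (C <= D)%O.
Proof.
apply/asboolP/andP => [BCD|[/asboolP BD /asboolP CD]].
  by split; apply/asboolP => x Bx; apply: BCD => E [_]; apply; [left|right].
apply: smallest_sub; first exact: subalgP.
by move=> x [/BD|/CD].
Qed.

HB.instance Definition _ := Order.POrder_MeetJoin_isLattice.Build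
  subalgebra_display (subalgebra A) subalg_meetP subalg_joinP.

End SubLattice.

Definition lattice_isomorphic d (L : latticeType d) d' (L' : latticeType d') :
    Prop :=
  exists f : {lmorphism L -> L'}, bijective f.

Definition algebraic_representation d (L : latticeType d) (A : algebra) : Prop :=
  lattice_isomorphic (subalgebra A) L.

(* Main.v *)
Require Import Defs.
From mathcomp Require Import all_boot all_order.
From mathcomp Require Import boolp classical_sets functions cardinality.
From HB Require Import structures.

(** Let the carrier consist of the subsets of [S], and choose operations that
    make the subalgebras exactly the families [{X | X \subset P}], one for each
    [P \subset S]. Such a family is determined by the singletons that it
    contains, so it is enough that a subalgebra contains [X] if and only if it
    contains [{s}] for every [s] in [X] ([closed_powerset_algebraP]). Two kinds
    of operations force this, each giving the empty set except at one tuple: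
    - an assembling operation sends the tuple of the singletons of [X] to [X];
      it is superfluous when [X] is itself a singleton, and for empty [X] it is
      the constant [set0], so that [2 ^ n - n] sets [X] need one;
    - a splitting operation sends [X] to [{s}], where [s] is in [X]; it is
      superfluous when [X] is a singleton, so that a set of [i >= 2] elements
      needs [i] of them.
    The default value [set0] lies in every family [{X | X \subset P}], and all
    these operations are distinct ([op_of_index_inj]), whence the count.
    Taking the singletons in a subalgebra is then an order isomorphism onto the
    power set, hence a lattice isomorphism. *)

Set Implicit Arguments.
Unset Strict Implicit.
Unset Printing Implicit Defensive.

Import Order.TTheory.

Lemma order_iso_lattice d (L : latticeType d) d' (L' : latticeType d')
    (f : L -> L') (g : L' -> L) :
  cancel f g -> cancel g f -> {mono f : x y / (x <= y)%O} ->
  lattice_isomorphic L L'.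
Proof.
move=> fK gK fmono.
have gmono : {mono g : x y / (x <= y)%O} by exact: can_mono gK fmono.
have fI : {morph f : x y / Order.meet x y}.
  move=> x y; apply/eqP; rewrite eq_le lexI !fmono leIl leIr /=.
  rewrite -gmono fK lexI -!fmono !gK.
  by rewrite leIl leIr.
have fU : {morph f : x y / Order.join x y}.
  move=> x y; apply/eqP; rewrite eq_le andbC leUx !fmono leUl leUr /=.
  rewrite -gmono fK leUx -!fmono !gK.
  by rewrite leUl leUr.
pose mI := Order.isMeetLatticeMorphism.Build d L d' L' f fI.
pose mU := Order.isJoinLatticeMorphism.Build d L d' L' f fU.
pose mO := Order.isOrderMorphism.Build d L d' L' f (mono2W fmono).
pose F : {lmorphism L -> L'} := HB.pack f mI mU mO.
by exists F; exists g.
Qed.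

Definition spike_op (T : finType) (t : seq {set T}) (v : {set T}) :
    operation {set T} :=
  @Operation _ (size t) (fun x => if tval x == t then v else finset.set0).

(** The point [t] is the only one at which [spike_op t v] is nonempty, so the
    operation determines both [t] and [v]; for empty [v] the point [t] would
    leave no trace except its size. *)
Lemma spike_op_inj (T : finType) (t u : seq {set T}) (v w : {set T}) :
  v != finset.set0 -> spike_op t v = spike_op u w -> t = u /\ v = w.
Proof.
move=> v0 etu.
have: exists2 x : (arity (spike_op t v)).-tuple {set T},
    tval x = t & spike_op t v x = v.
  by exists (in_tuple t); rewrite //= eqxx.
rewrite etu => -[x xt] /=; rewrite xt.
by case: eqP => [-> //|_ v0']; rewrite -v0' eqxx in v0.
Qed.

Definition assemble_op (T : finType) (X : {set T}) : operation {set T} :=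
  spike_op [seq [set s]%SET | s <- enum X] X.

Definition split_op (T : finType) (X : {set T}) (s : T) : operation {set T} :=
  spike_op [:: X] [set s]%SET.

Definition op_of_index (T : finType) (i : {set T} + {set T} * T) :
    operation {set T} :=
  match i with inl X => assemble_op X | inr (X, s) => split_op X s end.

(** The indices of the operations that are really needed: singletons need
    neither assembling nor splitting. *)
Definition op_index (T : finType) : pred ({set T} + {set T} * T) :=
  fun i => match i with
  | inl X => #|X| != 1
  | inr (X, s) => (1 < #|X|) && (s \in X)
  end.

Definition powerset_algebra (T : finType) : algebra :=
  @Algebra {set T} [set op_of_index i | i in [set` @op_index T]]%classic.

(** Every operation but one takes a nonempty value somewhere, so [spike_op_inj]
    recovers its index; the exception is the constant [set0], assembled from no
    singleton. Assembling cannot be confused with splitting, which is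
    unary, because the assembling of a set of one element is excluded. *)
Lemma op_of_index_inj (T : finType) :
  {in @op_index T &, injective (@op_of_index T)}.
Proof.
have set1_neq0 (s : T) : [set s]%SET != finset.set0.
  by rewrite -card_gt0 cards1.
have assemble_split (X Y : {set T}) s : #|X| != 1 ->
    assemble_op X <> split_op Y s.
  move=> X1 /esym/spike_op_inj[//|/(congr1 size) /=].
  by rewrite size_map -cardE => XE; rewrite -XE eqxx in X1.
move=> [X|[X s]] [Y|[Y r]]; rewrite /in_mem /= => Xi Yi.
- have [-> XY|X0 /spike_op_inj[] // _ -> //] := eqVneq X finset.set0.
  have [-> //|Y0] := eqVneq Y finset.set0.
  by have [] := spike_op_inj Y0 (esym XY) => _ ->.
- by move/assemble_split; case.
- by move/esym/assemble_split; case.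
- by move=> /spike_op_inj[] // [->] /set1_inj ->.
Qed.

Lemma closed_powerset_subsets (T : finType) (P : set T) :
  closed_under_ops (A := powerset_algebra T)
    [set X : {set T} | [set` X] `<=` P]%classic.
Proof.
move=> _ [[X|[X s]] /= Xi <-] x xP r /=.
- case: eqP => [xE|_]; last by rewrite finset.in_set0.
  move=> rX.
  have /tnthP[i ri] : [set r]%SET \in x by rewrite memtE xE map_f // mem_enum.
  by apply: (xP i); rewrite /= -ri set11.
- case: eqP => [xE|_]; last by rewrite finset.in_set0.
  move=> /set1P ->.
  have /andP[_ sX] := Xi.
  by apply: (xP ord0); rewrite /= (tnth_nth finset.set0) xE.
Qed.

(** The step by which a subalgebra gains elements: each operation acts as an
    inference rule with premises [t] and conclusion [v]. *)
Lemma subalgebra_spike (T : finType) (B : subalgebra (powerset_algebra T))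
    (t : seq {set T}) (v : {set T}) :
  ops (powerset_algebra T) (spike_op t v) ->
  {in t, forall X, subalg_set B X} -> subalg_set B v.
Proof.
move=> tv Bt; have := subalgP tv (x := in_tuple t).
rewrite [spike_op t v _]/= ifT //; apply=> i.
exact: Bt (mem_tnth i (in_tuple t)).
Qed.

(** Splitting gives one direction and assembling the other; when [X] is a
    singleton both are trivial. *)
Lemma closed_powerset_algebraP (T : finType)
    (B : subalgebra (powerset_algebra T)) (X : {set T}) :
  subalg_set B X <-> forall s, s \in X -> subalg_set B [set s]%SET.
Proof.
split=> [BX s sX|BX].
- have [/eqP/cards1P[r XE]|X1] := eqVneq #|X| 1.
    by move: sX BX; rewrite XE => /set1P ->.
  have X2 : 1 < #|X|.
    by rewrite ltn_neqAle eq_sym X1 card_gt0; apply/set0Pn; exists s.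
  apply: (@subalgebra_spike _ B [:: X]); last by move=> Y /[!inE] /eqP ->.
  by exists (inr (X, s)) => //=; apply/andP.
- have [/eqP/cards1P[r XE]|X1] := eqVneq #|X| 1.
    by rewrite XE; apply: BX; rewrite XE set11.
  apply: (@subalgebra_spike _ B [seq [set s]%SET | s <- enum X]).
    by exists (inl X).
  by move=> _ /mapP[s sX ->]; apply: BX; rewrite -mem_enum.
Qed.

Lemma powerset_algebra_representation (T : finType) :
  algebraic_representation (set T) (powerset_algebra T).
Proof.
pose f (B : subalgebra (powerset_algebra T)) : set T :=
  [set s | subalg_set B [set s]%SET]%classic.
pose g (P : set T) := Subalgebra (@closed_powerset_subsets T P).
apply: (@order_iso_lattice _ _ _ _ f g).
- move=> B; apply: subalgebra_inj; apply/seteqP; split=> X /=.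
    by move=> XB; apply/closed_powerset_algebraP.
  by move/closed_powerset_algebraP.
- move=> P; apply/seteqP; split=> s /=; first by apply; rewrite /= set11.
  by move=> Ps r /= /set1P ->.
- move=> B C; apply/idP/idP => [|/asboolP BC].
    rewrite subsetEset => BC; apply/asboolP => X /closed_powerset_algebraP BX.
    by apply/closed_powerset_algebraP => s /BX; apply: BC.
  by rewrite subsetEset => s; apply: BC.
Qed.

Lemma card_set (T : finType) : #|{set T}| = 2 ^ #|T|.
Proof. by rewrite -!cardsT -card_powerset powersetT. Qed.

(** Assembling operations are counted as the complement of the [n] singletons,
    splitting operations by the size of the set that they split. *)
Lemma card_op_index (T : finType) :
  #|@op_index T| = 2 ^ #|T| - #|T| + \sum_(2 <= i < #|T|.+1) i * 'C(#|T|, i).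
Proof.
rewrite -sum1_card big_sumType; congr addn.
  rewrite sum1dep_card -[X in _ - X]bin1 -card_draws -card_set.
  by rewrite cardsCs; congr (_ - _); apply: eq_card => X; rewrite !inE negbK.
rewrite (big_nat_widenl _ 0) // big_mkord.
transitivity (\sum_(X : {set T} | 1 < #|X|) #|X|).
  under [RHS]eq_bigr => X _ do rewrite -sum1_card.
  by rewrite pair_big_dep; apply: eq_bigl => -[].
have cardX (X : {set T}) : #|X| < #|T|.+1 by rewrite ltnS max_card.
rewrite (partition_big (fun X => Ordinal (cardX X)) (fun i => 1 < i)) //=.
apply: eq_bigr => i i1; rewrite -card_draws mulnC -sum_nat_const.
apply: eq_big => [X|X /andP[_ /eqP <-] //].
by rewrite inE -val_eqE /=; case: eqP => [->|_]; rewrite ?i1 ?andbF.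
Qed.

Lemma card_eq_finpred (T : finType) (P : {pred T}) : ([set` P] #= `I_#|P|)%card.
Proof.
have -> : [set` P]%classic =
    [set enum_val i | i in [set: 'I_#|P|]%classic]%classic.
  apply/seteqP; split=> [x /= Px|_ [i _ <-]]; last exact: enum_valP.
  by exists (enum_rank_in Px x) => //; rewrite enum_rankK_in.
rewrite card_eq_sym; apply: card_eq_trans card_II _; rewrite card_eq_sym.
by apply: inj_card_eq => i j _ _; apply: enum_val_inj.
Qed.

Theorem proposition7 (S : finType) (n : nat) (card_S : #|S| = n) :
  exists A : algebra,
    [/\ algebraic_representation (set S) A,
        ([set: A] #= `I_(2 ^ n))%card
      & (ops A #= `I_(2 ^ n - n + \sum_(2 <= i < n.+1) i * 'C(n, i)))%card].
Proof.
exists (powerset_algebra S).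
split; first exact: powerset_algebra_representation; rewrite -card_S.
- rewrite -card_set.
  suff -> : [set: {set S}]%classic = [set` predT]%classic.
    exact: card_eq_finpred.
  by apply/seteqP; split.
- rewrite -card_op_index; apply: card_eq_trans (card_eq_finpred _).
  by apply: inj_card_eq => i j /set_mem ? /set_mem ?; apply: op_of_index_inj.
Qed.
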